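(* If $G$ is a $\{P_4+P_1,C_4\}$-free graph, then $\mathsf{tree}\text{-}\theta(G)\le 3$.
   Context: All graphs are finite, simple and undirected. $P_4+P_1$ is the disjoint union of the 4-vertex path and a single vertex; $C_4$ is the 4-cycle. A graph is $\mathcal{F}$-free if it has no induced subgraph isomorphic to a member of $\mathcal{F}$. The clique cover number $\theta(H)$ is the minimum number of cliques in a partition of $V(H)$ into cliques. A tree decomposition of $G$ is a pair $(T,\{X_t\}_{t\in V(T)})$ with $T$ a tree and bags $X_t\subseteq V(G)$ such that every vertex lies in some bag, every edge has both endpoints in some bag, and for each vertex $v$ the nodes whose bags contain $v$ induce a connected subtree. The tree-clique-cover number $\mathsf{tree}\text{-}\theta(G)$ is the minimum, over all tree decompositions of $G$, of $\max_t \theta(G[X_t])$. *)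

(* Defs.v *)
From Stdlib Require List.
From mathcomp Require Import all_boot.
From mathcomp Require Import boolp.

Set Implicit Arguments.
Unset Strict Implicit.
Unset Printing Implicit Defensive.

Record sgraph := SGraph {
  vertex :> finType;
  edge : rel vertex;
  edge_sym : symmetric edge;
  edge_irrefl : irreflexive edge }.

Section Induced.
Variables (G : sgraph) (X : {set G}).

Definition induced_edge : rel {x : G | x \in X} :=
  fun x y => edge (val x) (val y).

Fact induced_edge_sym : symmetric induced_edge.
Proof. by move=> x y; exact: edge_sym. Qed.

Fact induced_edge_irrefl : irreflexive induced_edge.
Proof. by move=> x; exact: edge_irrefl. Qed.

Definition induced : sgraph := SGraph induced_edge_sym induced_edge_irrefl.
End Induced.

Definition isomorphic (G H : sgraph) : Prop :=
  exists f : G -> H,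
    bijective f /\ forall x y : G, edge (f x) (f y) = edge x y.

Definition free (F : seq sgraph) (G : sgraph) : Prop :=
  forall H : sgraph, List.In H F ->
    ~ exists X : {set G}, isomorphic (induced X) H.

Section Path.
Variable n : nat.

Definition path_edge : rel 'I_n :=
  fun i j => (i.+1 == j :> nat) || (j.+1 == i :> nat).

Fact path_edge_sym : symmetric path_edge.
Proof. by move=> i j; rewrite /path_edge orbC. Qed.

Fact path_edge_irrefl : irreflexive path_edge.
Proof. by move=> i; rewrite /path_edge orbb gtn_eqF. Qed.

Definition path_graph : sgraph := SGraph path_edge_sym path_edge_irrefl.
End Path.

Section Cycle.
Variable n : nat.

(* The condition i != j only matters for n = 1, where ordS has a fixed point;
   this is the n-cycle for n >= 3. *)
Definition cycle_edge : rel 'I_n :=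
  fun i j => (i != j) && ((ordS i == j) || (ordS j == i)).

Fact cycle_edge_sym : symmetric cycle_edge.
Proof. by move=> i j; rewrite /cycle_edge orbC eq_sym. Qed.

Fact cycle_edge_irrefl : irreflexive cycle_edge.
Proof. by move=> i; rewrite /cycle_edge eqxx. Qed.

Definition cycle_graph : sgraph := SGraph cycle_edge_sym cycle_edge_irrefl.
End Cycle.

Section DisjointUnion.
Variables G H : sgraph.

Definition dunion_edge : rel (G + H) := fun u v =>
  match u, v with
  | inl x, inl y => edge x y
  | inr x, inr y => edge x y
  | _, _ => false
  end.

Fact dunion_edge_sym : symmetric dunion_edge.
Proof. by move=> [x|x] [y|y] //=; exact: edge_sym. Qed.

Fact dunion_edge_irrefl : irreflexive dunion_edge.
Proof. by move=> [x|x] /=; exact: edge_irrefl. Qed.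

Definition dunion : sgraph := SGraph dunion_edge_sym dunion_edge_irrefl.
End DisjointUnion.

Definition clique (H : sgraph) (K : {set H}) : bool :=
  [forall x in K, forall y in K, (x != y) ==> edge x y].

Definition clique_partition (H : sgraph) (P : {set {set H}}) : bool :=
  partition P [set: H] && [forall K in P, clique K].

Fact clique_partition_ex (H : sgraph) :
  exists k, [exists P : {set {set H}}, clique_partition P && (#|P| == k)].
Proof.
pose P := preim_partition (@id H) setT.
exists #|P|; apply/existsP; exists P; rewrite eqxx andbT.
apply/andP; split; first exact: preim_partitionP.
apply/'forall_implyP => K /imsetP[z _ ->].
apply/'forall_implyP => x; rewrite !inE /= => /eqP <-.
apply/'forall_implyP => y; rewrite !inE /= => /eqP <-.
by rewrite eqxx.
Qed.

Definition theta (H : sgraph) : nat := ex_minn (clique_partition_ex H).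

Definition connected_graph (H : sgraph) : Prop :=
  forall x y : H, connect (@edge H) x y.

(* A sequence [:: x; y] along an edge satisfies ucycle, hence the bound 2. *)
Definition acyclic (H : sgraph) : Prop :=
  forall c : seq H, ucycle (@edge H) c -> size c <= 2.

Definition is_tree (T : sgraph) : Prop :=
  [/\ 0 < #|T|, connected_graph T & acyclic T].

Record tree_decomposition (G : sgraph) := TreeDecomposition {
  td_tree : sgraph;
  td_bag : td_tree -> {set G};
  td_treeP : is_tree td_tree;
  td_vertex : forall v : G, exists t, v \in td_bag t;
  td_edge : forall u v : G, edge u v ->
    exists t, (u \in td_bag t) && (v \in td_bag t);
  td_connected : forall v : G,
    connected_graph (induced [set t | v \in td_bag t]) }.

Definition td_theta (G : sgraph) (D : tree_decomposition G) : nat :=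
  \max_(t : td_tree D) theta (induced (td_bag t)).

Fact td_theta_ex (G : sgraph) :
  exists k, `[< exists D : tree_decomposition G, td_theta D = k >].
Proof.
have T1 : is_tree (path_graph 1).
  split; first by rewrite card_ord.
  - by move=> x y; rewrite (ord1 x) (ord1 y) connect0.
  - move=> c /andP[_ /card_uniqP <-].
    by apply: leq_trans (max_card _) _; rewrite card_ord.
have D : tree_decomposition G.
  apply: (@TreeDecomposition G (path_graph 1) (fun=> setT)) => //.
  - by move=> v; exists ord0; rewrite inE.
  - by move=> u v _; exists ord0; rewrite !inE.
  - move=> v x y; suff -> : x = y by exact: connect0.
    by apply: val_inj; rewrite (ord1 (val x)) (ord1 (val y)).
by exists (td_theta D); apply/asboolP; exists D.
Qed.

Definition tree_theta (G : sgraph) : nat := ex_minn (td_theta_ex G).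

(* Main.v *)
(* A vertex seeing a 5-cycle is adjacent to two consecutive vertices of it (a
   cap), to three consecutive ones (a clone) or to all (a hub), and only 5- and
   6-cycles occur as holes. If caps over two consecutive edges exist, the graph
   is the union of two sets, each covered by three cliques, with no edges
   between their differences. If caps exist over one edge only, either three
   cliques cover the graph, or deleting the caps leaves a set covered by three
   cliques and attached to the rest along a clique, so induction applies. If a
   hole exists but no 5-cycle has a cap, the graph is a blow-up of a 5- or
   6-cycle joined to a clique, covered by three cliques. A graph without holes
   has a simplicial vertex, which is removed by induction. *)
Require Import Defs.
From mathcomp Require Import all_boot.
From mathcomp Require Import boolp.

Set Implicit Arguments.
Unset Strict Implicit.
Unset Printing Implicit Defensive.

(* Every induced subgraph here is described through the reflexive closure [r]
   of adjacency: in [r] the patterns [C_4], [C_5], [C_6] and [P_4 + P_1] have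
   pairwise distinct rows, so no distinctness side conditions are needed. *)
Section Structure.
Variables (T : finType) (r : rel T).
Hypothesis rr : reflexive r.
Hypothesis rs : symmetric r.
Hypothesis C4_free : forall a b c d,
  r a b -> r b c -> r c d -> r d a -> ~~ r a c -> ~~ r b d -> False.
Hypothesis P4P1_free : forall a b c d p,
  r a b -> r b c -> r c d -> ~~ r a c -> ~~ r a d -> ~~ r b d ->
  ~~ r p a -> ~~ r p b -> ~~ r p c -> ~~ r p d -> False.

Ltac unpack := repeat match goal with
  | H : is_true (_ && _) |- _ => move/andP: H => [? ?] end.

Ltac symmetrise := repeat match goal with
  | H : is_true (r ?a ?b) |- _ =>
      lazymatch goal with
      | _ : is_true (r b a) |- _ => fail
      | _ => have : r b a by rewrite rs
      end; move=> ?
  | H : is_true (~~ r ?a ?b) |- _ =>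
      lazymatch goal with
      | _ : is_true (~~ r b a) |- _ => fail
      | _ => have : ~~ r b a by rewrite rs
      end; move=> ?
  end.

Ltac negate_goal := lazymatch goal with
  | |- is_true (~~ _) => apply/negP => ?
  | |- is_true _ => apply/negPn/negP => ?
  | |- _ => exfalso
  end.

(* Looks in the context for an induced [C_4] or [P_4 + P_1]. *)
Ltac contra := negate_goal; unpack; symmetrise;
  first
  [ match goal with
    | H : is_true (~~ r ?a ?a) |- _ => by move: H; rewrite rr
    | H : is_true (r ?a ?b), N : is_true (~~ r ?a ?b) |- _ => by move: N; rewrite H
    end
  | match goal with
    | H1 : is_true (r ?a ?b), H2 : is_true (r ?b ?c), N1 : is_true (~~ r ?a ?c),
      H3 : is_true (r ?c ?d), H4 : is_true (r ?d ?a), N2 : is_true (~~ r ?b ?d) |- _ =>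
        exact: (C4_free H1 H2 H3 H4 N1 N2)
    end
  | match goal with
    | H1 : is_true (r ?a ?b), H2 : is_true (r ?b ?c), N1 : is_true (~~ r ?a ?c),
      H3 : is_true (r ?c ?d), N2 : is_true (~~ r ?a ?d), N3 : is_true (~~ r ?b ?d),
      N4 : is_true (~~ r ?p ?a), N5 : is_true (~~ r ?p ?b), N6 : is_true (~~ r ?p ?c),
      N7 : is_true (~~ r ?p ?d) |- _ =>
        exact: (P4P1_free H1 H2 H3 N1 N2 N3 N4 N5 N6 N7)
    end ].

Ltac split_edge x y := let H := fresh "E" in case: (boolP (r x y)) => H.

Ltac conj := unpack; symmetrise; repeat (apply/andP; split); try assumption.

(** * Induced 5- and 6-cycles and how vertices attach to them *)

Definition C5 c1 c2 c3 c4 c5 :=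
  [&& r c1 c2, r c2 c3, r c3 c4, r c4 c5, r c5 c1,
      ~~ r c1 c3, ~~ r c2 c4, ~~ r c3 c5, ~~ r c4 c1 & ~~ r c5 c2].

Definition C6 c1 c2 c3 c4 c5 c6 :=
  [&& r c1 c2, r c2 c3, r c3 c4, r c4 c5, r c5 c6, r c6 c1,
      ~~ r c1 c3, ~~ r c2 c4, ~~ r c3 c5, ~~ r c4 c6, ~~ r c5 c1, ~~ r c6 c2,
      ~~ r c1 c4, ~~ r c2 c5 & ~~ r c3 c6].

(* Types of a vertex [v] relative to a 5-cycle [c1 ... c5]; the other
   types are obtained by rotating the arguments. *)
Definition cap c1 c2 c3 c4 c5 v :=
  [&& r v c1, r v c2, ~~ r v c3, ~~ r v c4 & ~~ r v c5].

Definition clone c1 c2 c3 c4 c5 v :=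
  [&& r v c1, r v c2, r v c5, ~~ r v c3 & ~~ r v c4].

Definition hub c1 c2 c3 c4 c5 v :=
  [&& r v c1, r v c2, r v c3, r v c4 & r v c5].

Definition clone6 c1 c2 c3 c4 c5 c6 v :=
  [&& r v c1, r v c2, r v c6, ~~ r v c3, ~~ r v c4 & ~~ r v c5].

Definition hub6 c1 c2 c3 c4 c5 c6 v :=
  [&& r v c1, r v c2, r v c3, r v c4, r v c5 & r v c6].

Ltac unfold_all := unfold C6, C5, cap, clone, hub, clone6, hub6 in *.

Ltac types_dec := repeat match goal with
  | |- context [cap ?a ?b ?c ?d ?e ?v] => case: (cap a b c d e v) => //=
  | |- context [clone ?a ?b ?c ?d ?e ?v] => case: (clone a b c d e v) => //=
  | |- context [hub ?a ?b ?c ?d ?e ?v] => case: (hub a b c d e v) => //=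
  | |- context [clone6 ?a ?b ?c ?d ?e ?f ?v] => case: (clone6 a b c d e f v) => //=
  | |- context [hub6 ?a ?b ?c ?d ?e ?f ?v] => case: (hub6 a b c d e f v) => //=
  | |- context [r ?a ?b] => case: (r a b) => //=
  end.

Lemma C5_rot c1 c2 c3 c4 c5 : C5 c1 c2 c3 c4 c5 -> C5 c2 c3 c4 c5 c1.
Proof. by move=> ?; unfold_all; conj. Qed.

Lemma C5_rev c1 c2 c3 c4 c5 : C5 c1 c2 c3 c4 c5 -> C5 c2 c1 c5 c4 c3.
Proof. by move=> ?; unfold_all; conj. Qed.

Section Types.
Variables c1 c2 c3 c4 c5 : T.
Local Notation cyc := (C5 c1 c2 c3 c4 c5).

Local Notation A1 := (cap c1 c2 c3 c4 c5).
Local Notation A2 := (cap c2 c3 c4 c5 c1).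
Local Notation A3 := (cap c3 c4 c5 c1 c2).
Local Notation A4 := (cap c4 c5 c1 c2 c3).
Local Notation A5 := (cap c5 c1 c2 c3 c4).
Local Notation B1 := (clone c1 c2 c3 c4 c5).
Local Notation B2 := (clone c2 c3 c4 c5 c1).
Local Notation B3 := (clone c3 c4 c5 c1 c2).
Local Notation B4 := (clone c4 c5 c1 c2 c3).
Local Notation B5 := (clone c5 c1 c2 c3 c4).
Local Notation U := (hub c1 c2 c3 c4 c5).

(** A vertex that sees two cycle vertices at distance two but not their common neighbour on the
    cycle closes a 4-cycle, and one with at most one neighbour on the cycle misses an induced [P_4]
    of it. This leaves two or three consecutive neighbours, or all five. As [r] is reflexive, a
    cycle vertex is a clone of itself. *)
Lemma C5_nbr v : cyc ->
  [|| A1 v, A2 v, A3 v, A4 v | A5 v] || [|| B1 v, B2 v, B3 v, B4 v, B5 v | U v].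
Proof.
move=> cC; apply/negPn/negP; unfold_all.
split_edge v c1; split_edge v c2; split_edge v c3; split_edge v c4;
split_edge v c5; rewrite //= => _; contra.
Qed.

(** Otherwise [y c3 c4 c5] is an induced [P_4] missed by [x]. *)
Lemma cap_next_adj x y : cyc -> A1 x -> A2 y -> r x y.
Proof. by move=> *; unfold_all; contra. Qed.

(** The path [x c2 c3 y] either closes to a 4-cycle or is an induced [P_4] missed by [c5]. *)
Lemma cap_opposite_absurd x y : cyc -> A1 x -> A3 y -> False.
Proof. by move=> *; unfold_all; split_edge x y; contra. Qed.

Lemma cap_clone1_adj x y : cyc -> A1 x -> B1 y -> r x y.
Proof. by move=> *; unfold_all; contra. Qed.

Lemma cap_clone2_adj x y : cyc -> A1 x -> B2 y -> r x y.
Proof. by move=> *; unfold_all; contra. Qed.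

(** An edge between [x] and [y] would close the 4-cycle [x y c3 c2]. *)
Lemma cap_clone4_nonadj x y : cyc -> A1 x -> B4 y -> ~~ r x y.
Proof. by move=> *; unfold_all; contra. Qed.

(** For nonadjacent [x] and [y], the path [a x c5 y] closes to a 4-cycle if [a] sees [y], and is an
    induced [P_4] missed by [c3] if not. *)
Lemma cap_clone15_adj a x y : cyc -> A1 a -> B1 x -> B5 y -> r x y.
Proof.
move=> cC Aa Bx By; have := cap_clone1_adj cC Aa Bx.
by unfold_all; split_edge a y => ?; contra.
Qed.

Lemma cap_clone23_adj a x y : cyc -> A1 a -> B2 x -> B3 y -> r x y.
Proof.
move=> cC Aa Bx By; have := cap_clone2_adj cC Aa Bx.
by unfold_all; split_edge a y => ?; contra.
Qed.

(** Nonadjacent [x] and [y] would form a 4-cycle with [z] and [c1], which both of them see. *)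
Lemma caps_first_clique x y z : cyc -> A1 x -> A1 y -> A2 z -> r x y.
Proof.
move=> cC Ax Ay Az; have := cap_next_adj cC Ax Az; have := cap_next_adj cC Ay Az => *.
by unfold_all; contra.
Qed.

Lemma caps_second_clique x y z : cyc -> A2 x -> A2 y -> A1 z -> r x y.
Proof.
move=> cC Ax Ay Az; have := cap_next_adj cC Az Ax; have := cap_next_adj cC Az Ay => *.
by unfold_all; contra.
Qed.

(** A hub seeing only one of [x] and [y] closes a 4-cycle through both of them and [c1] or [c3]. *)
Lemma hub_caps u x y : cyc -> U u -> A1 x -> A2 y -> r u x = r u y.
Proof.
move=> cC Uu Ax Ay; have := cap_next_adj cC Ax Ay => ?; unfold_all.
by split_edge u x; split_edge u y => //; contra.
Qed.

End Types.

(** * Three-clique covers and splittings *)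

Definition is_clique (K : {set T}) := {in K &, forall x y, r x y}.

(* The classes of the 3-colouring [f] are the three cliques. *)
Definition cover3 (W : {set T}) :=
  exists f : T -> 'I_3, {in W &, forall x y, f x = f y -> r x y}.

Lemma cover3P (W : {set T}) (K1 K2 K3 : pred T) :
  (forall v, v \in W -> [|| K1 v, K2 v | K3 v]) ->
  {in W &, forall x y, K1 x -> K1 y -> r x y} ->
  {in W &, forall x y, K2 x -> K2 y -> r x y} ->
  {in W &, forall x y, K3 x -> K3 y -> r x y} -> cover3 W.
Proof.
move=> KW H1 H2 H3.
(* The predicates may overlap; a vertex gets the colour of the first one that holds. *)
exists (fun v => if K1 v then inord 0 else if K2 v then inord 1 else inord 2).
move=> x y xW yW; move: (KW x xW) (KW y yW) (H1 x y xW yW) (H2 x y xW yW) (H3 x y xW yW).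
case: (K1 x) (K1 y) (K2 x) (K2 y) (K3 x) (K3 y) => [] [] [] [] [] [] //= _ _ h1 h2 h3;
  first [by move=> _; apply: h1 | by move=> _; apply: h2 | by move=> _; apply: h3
     | by move=> /(congr1 val); rewrite /= !inordK].
Qed.

Definition no_cross (Q R : {set T}) :=
  forall x y, x \in Q :\: R -> y \in R :\: Q -> ~~ r x y.

(** One step of the later recursion: [R] becomes a bag attached to a decomposition of [Q]. Either
    [Q] is itself a bag, or it is smaller than [W] and meets [R] in a clique, which some bag of its
    decomposition must contain. *)
Definition splits (W : {set T}) := exists Q R : {set T},
  [/\ W = Q :|: R, no_cross Q R, cover3 R &
      cover3 Q \/ (#|Q| < #|W| /\ is_clique (Q :&: R))].

Lemma splits_cover3 (W : {set T}) : cover3 W -> splits W.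
Proof.
move=> cW; exists W, W; split => //; [by rewrite setUid | | by left].
by move=> x y; rewrite setDv inE.
Qed.

(** * 5-cycles with caps *)

Section Cases.
Variables c1 c2 c3 c4 c5 : T.
Local Notation cyc := (C5 c1 c2 c3 c4 c5).

Local Notation A1 := (cap c1 c2 c3 c4 c5).
Local Notation A2 := (cap c2 c3 c4 c5 c1).
Local Notation B1 := (clone c1 c2 c3 c4 c5).
Local Notation B2 := (clone c2 c3 c4 c5 c1).
Local Notation B3 := (clone c3 c4 c5 c1 c2).
Local Notation B4 := (clone c4 c5 c1 c2 c3).
Local Notation B5 := (clone c5 c1 c2 c3 c4).
Local Notation U := (hub c1 c2 c3 c4 c5).

(** Caps over disjoint edges cannot coexist, and each of the other three edges is disjoint from
    [c1 c2] or from [c2 c3]. *)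
Lemma two_caps_types a1 a2 v : cyc -> A1 a1 -> A2 a2 ->
  [|| A1 v, A2 v, B1 v, B2 v, B3 v, B4 v, B5 v | U v].
Proof.
move=> cC Aa1 Aa2; have c2C := C5_rot cC; have c3C := C5_rot c2C.
have c4C := C5_rot c3C; have c5C := C5_rot c4C.
case/orP: (C5_nbr v cC) => [/or4P[->|->|Av|]|->]; rewrite ?orbT //.
  by case: (cap_opposite_absurd cC Aa1 Av).
by case/orP => Av; [case: (cap_opposite_absurd c4C Av Aa1)
                  | case: (cap_opposite_absurd c5C Av Aa2)].
Qed.

(* The vertices of [U] are either complete or anticomplete to [A1] and [A2];
   the two bags omit the anticomplete ones and the caps, respectively. *)
Lemma splits_two_caps W a1 a2 : cyc -> A1 a1 -> A2 a2 -> splits W.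
Proof.
move=> cC Aa1 Aa2.
have types v := two_caps_types v cC Aa1 Aa2.
have B1B5 := cap_clone15_adj cC Aa1.
have B3B4 := cap_clone23_adj (C5_rot cC) Aa2.
have A11 x y (Ax : A1 x) (Ay : A1 y) := caps_first_clique cC Ax Ay Aa2.
have A22 x y (Ax : A2 x) (Ay : A2 y) := caps_second_clique cC Ax Ay Aa1.
have UA2 u y (Uu : U u) (Ay : A2 y) : r u y = r u a1.
  by rewrite (hub_caps cC Uu Aa1 Ay).
have UA1 u y (Uu : U u) (Ay : A1 y) : r u y = r u a1.
  by rewrite (hub_caps cC Uu Ay Aa2) UA2.
exists [set v in W | ~~ (U v && ~~ r v a1)], [set v in W | ~~ (A1 v || A2 v)].
split; last left.
- apply/setP => v; rewrite !inE; case: (v \in W) => //=.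
  by apply/esym/negPn/negP; rewrite negb_or !negbK => /andP[/andP[Uv _] /orP[] Av];
    unfold_all; contra.
- move=> x y; rewrite !inE => /andP[xR /andP[xW _]] /andP[yQ /andP[yW _]].
  move: xR yQ; rewrite xW yW /= !negbK => Ax /andP[Uy ya]; rewrite rs.
  by case/orP: Ax => Ax; [rewrite UA1 | rewrite UA2].
- apply: (@cover3P _ [pred v | [|| B1 v, B5 v | U v]] [pred v | B3 v || B4 v] B2).
  + by move=> v; rewrite inE => /andP[_] /=; move: (types v); types_dec.
  + move=> x y _ _ /or3P[] Hx /or3P[] Hy;
    first [exact: B1B5 | rewrite rs; exact: B1B5 | unfold_all; contra].
  + move=> x y _ _ /orP[] Hx /orP[] Hy;
    first [exact: B3B4 | rewrite rs; exact: B3B4 | unfold_all; contra].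
  + by move=> x y _ _ Hx Hy; unfold_all; contra.
(* A hub kept here sees [a1], hence all caps, so it fits into one clique with [A1], [A2] and
   [B2]. *)
- apply: (@cover3P _ [pred v | [|| A1 v, A2 v, B2 v | U v && r v a1]]
                    [pred v | B1 v || B5 v] [pred v | B3 v || B4 v]).
  + move=> v; rewrite inE => /andP[_] /=; move: (types v); types_dec.
  + move=> x y _ _ /or4P[Hx|Hx|Hx|/andP[Hx Ex]] /or4P[Hy|Hy|Hy|/andP[Hy Ey]];
    first [exact: A11 | exact: A22 | by rewrite UA1 | by rewrite UA2
               | by rewrite rs UA1 | by rewrite rs UA2 | unfold_all; contra].
  + move=> x y _ _ /orP[] Hx /orP[] Hy;
    first [exact: B1B5 | rewrite rs; exact: B1B5 | unfold_all; contra].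
  + move=> x y _ _ /orP[] Hx /orP[] Hy;
    first [exact: B3B4 | rewrite rs; exact: B3B4 | unfold_all; contra].
Qed.

Section OneCap.
Variable W : {set T}.
Hypothesis no_two_caps : forall d1 d2 d3 d4 d5 x y,
  [&& d1 \in W, d2 \in W, d3 \in W, d4 \in W, d5 \in W, x \in W & y \in W] ->
  C5 d1 d2 d3 d4 d5 -> cap d1 d2 d3 d4 d5 x -> cap d2 d3 d4 d5 d1 y -> False.
Local Notation cW := [&& c1 \in W, c2 \in W, c3 \in W, c4 \in W & c5 \in W].

Lemma one_cap_types a v : cyc -> cW -> a \in W -> v \in W -> A1 a ->
  [|| A1 v, B1 v, B2 v, B3 v, B4 v, B5 v | U v].
Proof.
move=> cC cinW aW vW Aa; have c2C := C5_rot cC; have c3C := C5_rot c2C.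
have c4C := C5_rot c3C; have c5C := C5_rot c4C.
case/orP: (C5_nbr v cC) => [/or4P[->|Av|Av|]|->]; rewrite ?orbT //.
- by case: (no_two_caps _ cC Aa Av); conj.
- by case: (cap_opposite_absurd cC Aa Av).
- case/orP => Av; first by case: (cap_opposite_absurd c4C Av Aa).
  by case: (no_two_caps _ c5C Av Aa); conj.
Qed.

(** Otherwise replacing [c1] by [x] gives a 5-cycle on which [a] and [y] are caps over consecutive
    edges. *)
Lemma one_cap_clone12_adj a x y : cyc -> cW -> a \in W -> x \in W -> y \in W ->
  A1 a -> B1 x -> B2 y -> r x y.
Proof.
move=> cC cinW aW xW yW Aa Bx By; have ax := cap_clone1_adj cC Aa Bx; apply/negPn/negP => xy.
by apply: (@no_two_caps x c2 c3 c4 c5 a y); unfold_all; conj.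
Qed.

(** Otherwise replacing [c4] by [y] gives a 5-cycle on which [a] and [x] are caps over consecutive
    edges. *)
Lemma one_cap_clone34_adj a x y : cyc -> cW -> a \in W -> x \in W -> y \in W ->
  A1 a -> B3 x -> B4 y -> r x y.
Proof.
move=> cC cinW aW xW yW Aa Bx By; have ay := cap_clone4_nonadj cC Aa By; apply/negPn/negP => xy.
by apply: (@no_two_caps c1 c2 c3 y c5 a x); unfold_all; conj.
Qed.

(** All caps over [c1 c2] and all hubs turn out to see [b]. They also see [c1], which is not
    adjacent to [b], so [C_4]-freeness makes them a clique. *)
Lemma cover3_cap_adj_clone a b : cyc -> cW -> a \in W -> b \in W ->
  A1 a -> B3 b -> r a b -> cover3 W.
Proof.
move=> cC cinW aW bW Aa Bb ab.
have Ab x (Ax : A1 x) : r x b.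
  apply/negPn/negP => xb.
  (* On the cycle with [b] in place of [c3], [x] is still a cap, [a] is a clone of [c2] and [c3] a
     clone of [b]. This forces [a] to see [c3]. *)
  have c'C : C5 c1 c2 b c4 c5 by unfold_all; conj.
  have : r a c3 by apply: (cap_clone23_adj (a := x) c'C); unfold_all; conj.
  by move=> ?; unfold_all; contra.
have Ub x (Ux : U x) : r x b by clear Ab; unfold_all; contra.
apply: (@cover3P _ [pred v | [|| A1 v, B1 v, B2 v | U v]] [pred v | B3 v || B4 v] B5).
- by move=> v vW /=; move: (one_cap_types cC cinW aW vW Aa); types_dec.
- move=> x y xW yW /or4P[] Hx /or4P[] Hy;
  try first [by apply: (one_cap_clone12_adj cC cinW aW _ _ Aa)
            | by rewrite rs; apply: (one_cap_clone12_adj cC cinW aW _ _ Aa)];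
  (try have := Ab _ Hx); (try have := Ab _ Hy);
  (try have := Ub _ Hx); (try have := Ub _ Hy) => *;
  by clear Ab Ub; unfold_all; contra.
- move=> x y xW yW /orP[] Hx /orP[] Hy;
  first [by apply: (one_cap_clone34_adj cC cinW aW _ _ Aa)
             | by rewrite rs; apply: (one_cap_clone34_adj cC cinW aW _ _ Aa) | unfold_all; contra].
- by move=> x y _ _ Hx Hy; unfold_all; contra.
Qed.
End OneCap.
End Cases.

Section Graph.
Variable W : {set T}.

Section OneCap.
Hypothesis no_two_caps : forall d1 d2 d3 d4 d5 x y,
  [&& d1 \in W, d2 \in W, d3 \in W, d4 \in W, d5 \in W, x \in W & y \in W] ->
  C5 d1 d2 d3 d4 d5 -> cap d1 d2 d3 d4 d5 x -> cap d2 d3 d4 d5 d1 y -> False.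

(* If no cap meets [B3] or [B5], the caps are cut off by the clique formed by
   [B1], [B2] and [U]. *)
Lemma splits_one_cap c1 c2 c3 c4 c5 a :
  [&& c1 \in W, c2 \in W, c3 \in W, c4 \in W & c5 \in W] -> a \in W ->
  C5 c1 c2 c3 c4 c5 -> cap c1 c2 c3 c4 c5 a -> splits W.
Proof.
move=> cinW aW cC Aa.
pose A1 := cap c1 c2 c3 c4 c5; pose U := hub c1 c2 c3 c4 c5.
pose B1 := clone c1 c2 c3 c4 c5; pose B2 := clone c2 c3 c4 c5 c1.
pose B3 := clone c3 c4 c5 c1 c2; pose B4 := clone c4 c5 c1 c2 c3.
pose B5 := clone c5 c1 c2 c3 c4.
have types v (vW : v \in W) : [|| A1 v, B1 v, B2 v, B3 v, B4 v, B5 v | U v] :=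
  one_cap_types no_two_caps cC cinW aW vW Aa.
case: (boolP [exists x in W, exists y in W, [&& A1 x, B3 y & r x y]]).
  case/exists_inP => x xW /exists_inP[y yW /and3P[Ax By xy]].
  exact/splits_cover3/(cover3_cap_adj_clone no_two_caps cC cinW xW yW Ax By xy).
move=> A1B3.
case: (boolP [exists x in W, exists y in W, [&& A1 x, B5 y & r x y]]).
  case/exists_inP => x xW /exists_inP[y yW /and3P[Ax By xy]].
  (* The reflection swapping [c1] and [c2] preserves [A1] and exchanges [B3] with [B5]. *)
  apply/splits_cover3/(cover3_cap_adj_clone no_two_caps (C5_rev cC) _ xW yW _ _ xy);
    by clear -Ax By cinW; unfold A1, B5, cap, clone in *; conj.
move=> A1B5.
have K12U : {in W &, forall x y, [|| B1 x, B2 x | U x] -> [|| B1 y, B2 y | U y] -> r x y}.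
  move=> x y xW yW; clear A1B3 A1B5 types.
  by move=> /or3P[] Hx /or3P[] Hy;
    try first [exact: (one_cap_clone12_adj no_two_caps cC cinW aW xW yW Aa Hx Hy)
              | rewrite rs; exact: (one_cap_clone12_adj no_two_caps cC cinW aW yW xW Aa Hy Hx)];
    unfold A1, B1, B2, U in *; clear no_two_caps; unfold_all; contra.
exists [set v in W | [|| A1 v, B1 v, B2 v | U v]], [set v in W | ~~ A1 v].
split; last right.
- by apply/setP => v; rewrite !inE; case: (v \in W) => //=; case: (A1 v); rewrite ?orbT.
- move=> x y; rewrite !inE => /andP[+ /andP[xW _]] /andP[+ /andP[yW _]].
  rewrite xW yW /= negbK => Ax yQ; apply/negP => xy.
  have : [|| B3 y, B4 y | B5 y].
    move: (types y yW) yQ.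
    by case: (A1 y) (B1 y) (B2 y) (U y) => [] [] [] []; rewrite ?orbF.
  case/or3P => By.
  + case/negP: A1B3; apply/exists_inP; exists x => //.
    by apply/exists_inP; exists y => //; apply/and3P.
  + by move: (cap_clone4_nonadj cC Ax By); rewrite xy.
  + case/negP: A1B5; apply/exists_inP; exists x => //.
    by apply/exists_inP; exists y => //; apply/and3P.
- apply: (@cover3P _ [pred v | [|| B1 v, B2 v | U v]] [pred v | B3 v || B4 v] B5).
  + move=> v; rewrite inE => /andP[vW] /=; move: (types v vW).
    by case: (A1 v) (B1 v) (B2 v) (B3 v) (B4 v) (B5 v) (U v) => [] [] [] [] [] [] [].
  + by move=> x y; rewrite !inE => /andP[xW _] /andP[yW _]; apply: K12U.
  + move=> x y; rewrite !inE => /andP[xW _] /andP[yW _].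
    by case/orP=> Hx /orP[] Hy;
      try first [exact: (one_cap_clone34_adj no_two_caps cC cinW aW xW yW Aa Hx Hy)
                | rewrite rs; exact: (one_cap_clone34_adj no_two_caps cC cinW aW yW xW Aa Hy Hx)];
      unfold B3, B4 in Hx, Hy; clear -Hx Hy cC rs rr C4_free P4P1_free; unfold_all; contra.
  + move=> x y _ _ Hx Hy.
    by unfold B5 in Hx, Hy; clear -Hx Hy cC rs rr C4_free P4P1_free; unfold_all; contra.
- split.
    apply: proper_card; apply/properP; split; first by apply/subsetP => v; rewrite inE => /andP[].
    (* Every vertex of the first set sees [c1], whereas [c4] does not. *)
    exists c4; first by case/and5P: cinW.
    rewrite inE; apply/negP => /andP[_ H].
    move: H => /or4P[] H;
      by unfold A1, B1, B2, U in H; clear -H cC rs rr C4_free P4P1_free; unfold_all; contra.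
  move=> x y; rewrite !inE => /andP[/andP[xW Hx] /andP[_ Ax]] /andP[/andP[yW Hy] /andP[_ Ay]].
  by apply: K12U => //; move: Hx Hy; rewrite (negbTE Ax) (negbTE Ay).
Qed.
End OneCap.

(** * Holes in the absence of caps *)

(** Only clones and hubs remain. Clones of consecutive cycle vertices are adjacent, since otherwise
    putting one of them into the cycle turns the other into a cap. *)
Lemma cover3_C5 c1 c2 c3 c4 c5 :
  (forall d1 d2 d3 d4 d5 x,
    [&& d1 \in W, d2 \in W, d3 \in W, d4 \in W, d5 \in W & x \in W] ->
    C5 d1 d2 d3 d4 d5 -> ~~ cap d1 d2 d3 d4 d5 x) ->
  [&& c1 \in W, c2 \in W, c3 \in W, c4 \in W & c5 \in W] ->
  C5 c1 c2 c3 c4 c5 -> cover3 W.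
Proof.
move=> no_cap cinW cC.
have BB d1 d2 d3 d4 d5 : [&& d1 \in W, d2 \in W, d3 \in W, d4 \in W & d5 \in W] ->
    C5 d1 d2 d3 d4 d5 -> {in W &, forall x y,
    clone d1 d2 d3 d4 d5 x -> clone d2 d3 d4 d5 d1 y -> r x y}.
  move=> dW dC x y xW yW Bx By; apply/negPn/negP => xy.
  have /negP : ~~ cap d2 d3 d4 d5 x y by apply: no_cap; unfold_all; conj.
  by apply; unfold_all; conj.
have c2C := C5_rot cC; have c3C := C5_rot c2C.
have c4C := C5_rot c3C; have c5C := C5_rot c4C.
have B12 := BB _ _ _ _ _ cinW cC.
have B34 : {in W &, forall x y,
    clone c3 c4 c5 c1 c2 x -> clone c4 c5 c1 c2 c3 y -> r x y}.
  by apply: (BB _ _ _ _ _ _ c3C); conj.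
apply: (@cover3P _
  [pred v | [|| clone c1 c2 c3 c4 c5 v, clone c2 c3 c4 c5 c1 v | hub c1 c2 c3 c4 c5 v]]
  [pred v | clone c3 c4 c5 c1 c2 v || clone c4 c5 c1 c2 c3 v]
  (clone c5 c1 c2 c3 c4)).
- move=> v vW /=; move: (C5_nbr v cC).
  rewrite !(negbTE (no_cap _ _ _ _ _ v _ _)) //=; try by conj.
  by types_dec.
- by move=> x y xW yW /or3P[] Hx /or3P[] Hy;
    try first [exact: B12 | rewrite rs; exact: B12];
    clear no_cap BB B12 B34; unfold_all; contra.
- by move=> x y xW yW /orP[] Hx /orP[] Hy;
    try first [exact: B34 | rewrite rs; exact: B34];
    clear no_cap BB B12 B34; unfold_all; contra.
- by move=> x y xW yW Hx Hy; clear no_cap BB B12 B34; unfold_all; contra.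
Qed.

Hypothesis no_C5 : forall d1 d2 d3 d4 d5,
  [&& d1 \in W, d2 \in W, d3 \in W, d4 \in W & d5 \in W] -> ~~ C5 d1 d2 d3 d4 d5.

(** If [v] sees two opposite cycle vertices and neither vertex of one side between them, it closes a
    5-cycle there. [C_4]-freeness fills gaps of length one, and a [P_4] on the cycle excludes fewer
    than three neighbours. *)
Lemma C6_nbr c1 c2 c3 c4 c5 c6 v :
  [&& c1 \in W, c2 \in W, c3 \in W, c4 \in W, c5 \in W & c6 \in W] ->
  v \in W -> C6 c1 c2 c3 c4 c5 c6 ->
  [|| clone6 c1 c2 c3 c4 c5 c6 v, clone6 c2 c3 c4 c5 c6 c1 v,
      clone6 c3 c4 c5 c6 c1 c2 v, clone6 c4 c5 c6 c1 c2 c3 v,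
      clone6 c5 c6 c1 c2 c3 c4 v, clone6 c6 c1 c2 c3 c4 c5 v
    | hub6 c1 c2 c3 c4 c5 c6 v].
Proof.
move=> cinW vW cC.
have no4 d1 d2 d3 d4 d5 d6 :
    [&& d1 \in W, d2 \in W, d3 \in W, d4 \in W, d5 \in W & d6 \in W] ->
    C6 d1 d2 d3 d4 d5 d6 -> ~~ [&& r v d1, r v d4, ~~ r v d5 & ~~ r v d6].
  move=> dW dC; apply/negP => Hv.
  have /negP : ~~ C5 v d4 d5 d6 d1 by apply: no_C5; conj.
  by apply; unfold_all; conj.
have n1 : ~~ [&& r v c1, r v c4, ~~ r v c5 & ~~ r v c6] by apply: no4 cC; conj.
have n2 : ~~ [&& r v c2, r v c5, ~~ r v c6 & ~~ r v c1].
  by apply: (@no4 c2 c3 c4 c5 c6 c1); unfold_all; conj.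
have n3 : ~~ [&& r v c3, r v c6, ~~ r v c1 & ~~ r v c2].
  by apply: (@no4 c3 c4 c5 c6 c1 c2); unfold_all; conj.
have n4 : ~~ [&& r v c4, r v c1, ~~ r v c2 & ~~ r v c3].
  by apply: (@no4 c4 c5 c6 c1 c2 c3); unfold_all; conj.
have n5 : ~~ [&& r v c5, r v c2, ~~ r v c3 & ~~ r v c4].
  by apply: (@no4 c5 c6 c1 c2 c3 c4); unfold_all; conj.
have n6 : ~~ [&& r v c6, r v c3, ~~ r v c4 & ~~ r v c5].
  by apply: (@no4 c6 c1 c2 c3 c4 c5); unfold_all; conj.
clear no4; apply/negPn/negP; unfold_all; move: n1 n2 n3 n4 n5 n6.
by split_edge v c1; split_edge v c2; split_edge v c3; split_edge v c4;
  split_edge v c5; split_edge v c6; rewrite //= => _ _ _ _ _ _ _; contra.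
Qed.

(** Consecutive clones are adjacent: otherwise the clone of [c1] forms with [c6], [c5], [c4] an
    induced [P_4] missed by the clone of [c2]. Pairing consecutive classes gives the three
    cliques. *)
Lemma cover3_C6 c1 c2 c3 c4 c5 c6 :
  [&& c1 \in W, c2 \in W, c3 \in W, c4 \in W, c5 \in W & c6 \in W] ->
  C6 c1 c2 c3 c4 c5 c6 -> cover3 W.
Proof.
move=> cinW cC.
apply: (@cover3P _ [pred v | [|| clone6 c1 c2 c3 c4 c5 c6 v,
    clone6 c2 c3 c4 c5 c6 c1 v | hub6 c1 c2 c3 c4 c5 c6 v]]
  [pred v | clone6 c3 c4 c5 c6 c1 c2 v || clone6 c4 c5 c6 c1 c2 c3 v]
  [pred v | clone6 c5 c6 c1 c2 c3 c4 v || clone6 c6 c1 c2 c3 c4 c5 v]).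
- move=> v vW /=; move: (C6_nbr cinW vW cC).
  by types_dec.
- by move=> x y _ _ /or3P[] Hx /or3P[] Hy; unfold_all; contra.
- by move=> x y _ _ /orP[] Hx /orP[] Hy; unfold_all; contra.
- by move=> x y _ _ /orP[] Hx /orP[] Hy; unfold_all; contra.
Qed.
End Graph.

(** * Connected sets and simplicial vertices *)

(* Connectedness by the absence of a proper nonempty part without outgoing
   edges. *)
Definition conn (C : {set T}) := [forall X : {set T},
  [&& X != set0, X \subset C & [forall u in X, forall w in C, r u w ==> (w \in X)]]
    ==> (C \subset X)].

Lemma connP (C : {set T}) : reflect (forall X : {set T}, X != set0 -> X \subset C ->
    {in X & C, forall u w, r u w -> w \in X} -> C \subset X) (conn C).
Proof.
apply: (iffP forallP) => [H X X0 XC Xcl|H X].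
  apply: (implyP (H X)); rewrite X0 XC; apply/forall_inP => u uX.
  by apply/forall_inP => w wC; apply/implyP/Xcl.
apply/implyP => /and3P[X0 XC Xcl]; apply: H => // u w uX wC.
by move/forall_inP: Xcl => /(_ u uX) /forall_inP /(_ w wC) /implyP.
Qed.

Lemma conn1 x : conn [set x].
Proof.
apply/connP => X /set0Pn[z zX] Xx _; rewrite sub1set.
by move/subsetP: Xx => /(_ z zX); rewrite inE => /eqP <-.
Qed.

Lemma connU1 (C : {set T}) s c : conn C -> c \in C -> r s c -> conn (s |: C).
Proof.
move=> /connP cC cinC sc; apply/connP => X /set0Pn[p pX] /subsetP XC Xcl.
have CX : C \subset X.
  suff : C \subset X :&: C by rewrite subsetI => /andP[].
  apply: cC; rewrite ?subsetIr //.
    have := XC p pX; rewrite !inE => /orP[/eqP ps|pC].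
      apply/set0Pn; exists c; rewrite inE cinC andbT.
      by apply: (Xcl p); rewrite // ?ps // !inE cinC orbT.
    by apply/set0Pn; exists p; rewrite inE pX.
  move=> u w /setIP[uX uC] wC uw; rewrite inE wC andbT.
  by apply: (Xcl u) => //; rewrite inE wC orbT.
rewrite subUset CX andbT sub1set.
by apply: (Xcl c); rewrite ?(subsetP CX) // ?inE ?eqxx // rs.
Qed.

(* Off the neighbourhood of [x] the graph has no induced [P_4]. *)
Lemma conn_dist2 (C : {set T}) x p q : conn C -> {in C, forall z, ~~ r x z} ->
  p \in C -> q \in C -> exists2 m, m \in C & r p m && r m q.
Proof.
move=> /connP cC xC pC qC.
pose X := [set z in C | [exists m in C, r p m && r m z]].
suff /subsetP/(_ q qC) : C \subset X by rewrite inE => /andP[_ /exists_inP].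
apply: cC.
- by apply/set0Pn; exists p; rewrite inE pC; apply/exists_inP; exists p; rewrite ?rr.
- by apply/subsetP => z; rewrite inE => /andP[].
(* If [w] were not within distance two of [p], then [p m u w] would be an induced [P_4] missed by
   [x]. *)
move=> u w; rewrite !inE => /andP[uC /exists_inP[m mC /andP[pm mu]]] wC uw.
rewrite wC; apply/exists_inP.
case: (boolP (r p u)) => [pu|pu]; first by exists u; rewrite ?pu.
case: (boolP (r p w)) => [pw|pw]; first by exists w; rewrite ?pw ?rr.
case: (boolP (r m w)) => [mw|mw]; first by exists m; rewrite ?pm.
by have := (xC _ pC); have := (xC _ mC); have := (xC _ uC); have := (xC _ wC) => *; contra.
Qed.

(* Choose a vertex [x] and a connected set [C] anticomplete to [x] with [C] as
   large as possible. By maximality every vertex of the remainder [M] of [W]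
   is complete to the neighbourhood [S] of [C], and two nonadjacent vertices of
   [S] would close, through [C] and [x], a cycle of length 4, 5 or 6. Hence a
   simplicial vertex of [M] is simplicial in [W]. *)
Lemma simplicial_vertex (W : {set T}) :
  (forall d1 d2 d3 d4 d5,
    [&& d1 \in W, d2 \in W, d3 \in W, d4 \in W & d5 \in W] -> ~~ C5 d1 d2 d3 d4 d5) ->
  (forall d1 d2 d3 d4 d5 d6,
    [&& d1 \in W, d2 \in W, d3 \in W, d4 \in W, d5 \in W & d6 \in W] ->
    ~~ C6 d1 d2 d3 d4 d5 d6) ->
  W != set0 -> exists2 v, v \in W & is_clique [set u in W | r v u].
Proof.
elim: {W}_.+1 {-2}W (ltnSn #|W|) => // n IH W Wn no_C5 no_C6 W0.
have [all_adj|] := boolP [forall x in W, forall y in W, r x y].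
  case/set0Pn: W0 => v vW; exists v => // x y; rewrite !inE => /andP[xW _] /andP[yW _].
  by move/forall_inP: all_adj => /(_ x xW) /forall_inP; apply.
case/forall_inPn => x0 x0W /forall_inPn[y0 y0W x0y0].
pose P (q : T * {set T}) := [&& q.1 \in W, q.2 \subset W, q.2 != set0, conn q.2 &
  [forall z in q.2, ~~ r q.1 z]].
have P0 : P (x0, [set y0]).
  rewrite /P /= x0W sub1set y0W conn1 /=; apply/andP; split.
    by apply/set0Pn; exists y0; rewrite inE.
  by apply/forall_inP => z; rewrite inE => /eqP ->.
case: (@arg_maxnP _ _ P (fun q => #|q.2|) P0) => -[x C].
case/and5P => /= xW CW C0 cC /forall_inP xC maxC.
pose S := [set s in W | (s \notin C) && [exists c in C, r s c]].
pose M := W :\: (C :|: S).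
have MC v : v \in M -> {in C, forall c, ~~ r v c}.
  rewrite !inE => /andP[/norP[vC vS] vW] c cinC.
  by apply: contra vS => vc; rewrite vW vC; apply/exists_inP; exists c.
have MS : {in M & S, forall v s, r v s}.
  move=> v s vM; rewrite inE => /and3P[sW sC /exists_inP[c cinC sc]].
  apply/negPn/negP => vs.
  (* With [v] in the role of [x], adding [s] to [C] would beat the maximal pair. *)
  have : P (v, s |: C).
    rewrite /P /= subUset sub1set sW CW (connU1 cC cinC sc).
    have -> /= : v \in W by move: vM; rewrite inE => /andP[].
    apply/andP; split; first by apply/set0Pn; exists s; rewrite setU11.
    by apply/forall_inP => z; rewrite !inE => /orP[/eqP ->//|]; apply: MC.
  by move/maxC; rewrite /= cardsU1 sC ltnn.
have xM : x \in M.
  rewrite !inE xW andbT; apply/norP; split.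
    by apply/negP => /xC; rewrite rr.
  by apply/negP => /and3P[_ _ /exists_inP[c /xC /negbTE ->]].
have Scl : {in S &, forall s t, r s t}.
  move=> s t sS tS; apply/negPn/negP => st.
  have xs := MS _ _ xM sS; have xt := MS _ _ xM tS.
  move: sS tS; rewrite !inE => /and3P[sW sC /exists_inP[p pC sp]].
  move=> /and3P[tW tC /exists_inP[q qC tq]].
  have [m mC /andP[pm mq]] := conn_dist2 cC xC pC qC.
  have xp := xC _ pC; have xq := xC _ qC; have xm := xC _ mC.
  have [pW qW mW] : [/\ p \in W, q \in W & m \in W] by rewrite !(subsetP CW).
  (* [n1] serves when [p] and [q] are adjacent, [n2] and [n3] when exactly one of [s] and [t] sees
     [m], and [n4] when none of these edges exists. *)
  have n1 : ~~ C5 x s p q t by apply: no_C5; conj.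
  have n2 : ~~ C5 x s m q t by apply: no_C5; conj.
  have n3 : ~~ C5 x s p m t by apply: no_C5; conj.
  have n4 : ~~ C6 x s p m q t by apply: no_C6; conj.
  clear -n1 n2 n3 n4 xp xq xm pm mq tq sp xs xt st rr rs C4_free P4P1_free.
  split_edge s q; first by contra.
  split_edge t p; first by contra.
  split_edge s m; split_edge t m; split_edge p q; first
  [ by contra | case/negP: n1; by unfold_all; conj | case/negP: n2; by unfold_all; conj
  | case/negP: n3; by unfold_all; conj | case/negP: n4; by unfold_all; conj ].
have MW : M \subset W by rewrite subsetDl.
have MltW : #|M| < #|W|.
  apply: proper_card; apply/properP; split=> //; case/set0Pn: C0 => y yC.
  by exists y; rewrite ?(subsetP CW) // !inE yC.
have [||||v vM vcl] := IH M.
- by rewrite -ltnS; apply: leq_trans Wn.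
- by move=> ? ? ? ? ? ?; apply: no_C5; unpack; rewrite !(subsetP MW).
- by move=> ? ? ? ? ? ? ?; apply: no_C6; unpack; rewrite !(subsetP MW).
- by apply/set0Pn; exists x.
exists v; first exact: (subsetP MW).
have SM u : u \in W -> r v u -> (u \in S) || (u \in M).
  move=> uW vu; rewrite -[u \in S]orbF orbC; case: (boolP (u \in M)) => // uM.
  move: uM; rewrite in_setD uW andbT negbK inE => /orP[/(MC v vM)|->//].
  by rewrite vu.
move=> a b; rewrite !inE => /andP[aW va] /andP[bW vb].
case/orP: (SM a aW va) => Ha; case/orP: (SM b bW vb) => Hb.
- exact: Scl.
- by rewrite rs; apply: MS.
- exact: MS.
- by apply: vcl; rewrite inE ?Ha ?Hb.
Qed.

Lemma cover3_clique (K : {set T}) : is_clique K -> cover3 K.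
Proof. by move=> clK; exists (fun=> ord0) => x y xK yK _; apply: clK. Qed.

(** The closed neighbourhood of [v] meets the rest in the open one, which is a clique. *)
Lemma splits_simplicial (W : {set T}) v :
  v \in W -> is_clique [set u in W | r v u] -> splits W.
Proof.
move=> vW clv; exists (W :\ v), [set u in W | r v u]; split.
- apply/setP => u; rewrite !inE; case: (eqVneq u v) => [->|_] /=; first by rewrite vW rr.
  by case: (u \in W).
- move=> x y; rewrite !inE => /andP[+ /andP[_ xW]] /andP[+ /andP[yW _]].
  by rewrite xW yW andbT negbK /= rs => vx /eqP ->.
- exact: cover3_clique.
right; split; first by rewrite (cardsD1 v W) vW.
by move=> x y /setIP[_ xR] /setIP[_ yR]; apply: clv.
Qed.

Lemma splitsP (W : {set T}) : splits W.
Proof.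
case: (pselect (exists d1 d2 d3 d4 d5 x y, [/\
  [&& d1 \in W, d2 \in W, d3 \in W, d4 \in W, d5 \in W, x \in W & y \in W],
  C5 d1 d2 d3 d4 d5, cap d1 d2 d3 d4 d5 x & cap d2 d3 d4 d5 d1 y])).
  by case=> d1 [d2 [d3 [d4 [d5 [x [y [_ dC Ax Ay]]]]]]]; apply: splits_two_caps dC Ax Ay.
move=> no_two_caps.
case: (pselect (exists d1 d2 d3 d4 d5 x, [/\
  [&& d1 \in W, d2 \in W, d3 \in W, d4 \in W & d5 \in W], x \in W,
  C5 d1 d2 d3 d4 d5 & cap d1 d2 d3 d4 d5 x])).
  case=> d1 [d2 [d3 [d4 [d5 [x [dW xW dC Ax]]]]]].
  apply: (splits_one_cap _ dW xW dC Ax) => e1 e2 e3 e4 e5 y z eW eC Ay Az.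
  by apply: no_two_caps; exists e1, e2, e3, e4, e5, y, z.
move=> no_cap.
case: (pselect (exists d1 d2 d3 d4 d5,
  [&& d1 \in W, d2 \in W, d3 \in W, d4 \in W & d5 \in W] /\ C5 d1 d2 d3 d4 d5)).
  case=> d1 [d2 [d3 [d4 [d5 [dW dC]]]]].
  apply/splits_cover3/(cover3_C5 _ dW dC) => e1 e2 e3 e4 e5 x eW eC.
  by apply/negP => Ax; apply: no_cap; exists e1, e2, e3, e4, e5, x; split=> //; conj.
move=> no_C5'; have no_C5 d1 d2 d3 d4 d5 :
    [&& d1 \in W, d2 \in W, d3 \in W, d4 \in W & d5 \in W] -> ~~ C5 d1 d2 d3 d4 d5.
  by move=> dW; apply/negP => dC; apply: no_C5'; exists d1, d2, d3, d4, d5.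
case: (pselect (exists d1 d2 d3 d4 d5 d6,
  [&& d1 \in W, d2 \in W, d3 \in W, d4 \in W, d5 \in W & d6 \in W] /\
  C6 d1 d2 d3 d4 d5 d6)).
  case=> d1 [d2 [d3 [d4 [d5 [d6 [dW dC]]]]]].
  exact/splits_cover3/(cover3_C6 no_C5 dW dC).
move=> no_C6'; have no_C6 d1 d2 d3 d4 d5 d6 :
    [&& d1 \in W, d2 \in W, d3 \in W, d4 \in W, d5 \in W & d6 \in W] ->
    ~~ C6 d1 d2 d3 d4 d5 d6.
  by move=> dW; apply/negP => dC; apply: no_C6'; exists d1, d2, d3, d4, d5, d6.
have [->|W0] := eqVneq W set0.
  by apply/splits_cover3/cover3_clique => x y; rewrite inE.
have [v vW clv] := simplicial_vertex no_C5 no_C6 W0.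
exact: splits_simplicial vW clv.
Qed.
End Structure.

(** * Trees with an added leaf *)

Lemma connect_homo (S T : finType) (e : rel S) (e' : rel T) (f : S -> T) :
  (forall x y, e x y -> connect e' (f x) (f y)) ->
  forall x y, connect e x y -> connect e' (f x) (f y).
Proof.
move=> fe x y /connectP[p + ->] {y}; elim: p x => [|z p IH] x /=.
  by rewrite connect0.
by case/andP=> /fe xz /IH; apply: connect_trans.
Qed.

Section AddLeaf.
Variables (T : sgraph) (t0 : T).

Definition leaf_edge : rel (option T) := fun s t =>
  match s, t with
  | Some x, Some y => edge x y
  | None, Some y => y == t0
  | Some x, None => x == t0
  | None, None => false
  end.

Fact leaf_edge_sym : symmetric leaf_edge.
Proof. by move=> [x|] [y|] //=; exact: edge_sym. Qed.

Fact leaf_edge_irrefl : irreflexive leaf_edge.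
Proof. by move=> [x|] //=; exact: edge_irrefl. Qed.

Definition add_leaf : sgraph := SGraph leaf_edge_sym leaf_edge_irrefl.

(** A cycle avoiding the leaf lies in [T]. On a cycle through it, both neighbours of the leaf are
    [t0], so they coincide and the length is at most 2. *)
Lemma add_leaf_acyclic : acyclic T -> acyclic add_leaf.
Proof.
move=> acT c cc.
have [Nc|Nc] := boolP (None \in c); last first.
  have cE : c = map Some (pmap id c).
    by elim: c Nc {cc} => //= -[x|] c IH; rewrite inE => // /norP[_ /IH {1}->].
  rewrite cE size_map; apply: acT; move: cc; rewrite {1}cE /ucycle => /andP[cc uc].
  apply/andP; split; last by move: uc; rewrite cE map_inj_uniq // => ? ? [].
  case: (pmap id c) cc => //= x p; rewrite -map_rcons.
  by rewrite path_map.
have [i p cE] := rot_to Nc.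
rewrite -(size_rot i) cE; move: cc; rewrite -(rot_ucycle i) cE {Nc cE}.
case/andP; case/lastP: p => [|p z] //; case: p => [|y p] //=.
rewrite rcons_path last_rcons rcons_uniq => /andP[Ny /andP[_ zN]].
case: y Ny => //= y /eqP ->; case: z zN => //= z /eqP ->.
by rewrite mem_rcons mem_head andbF.
Qed.

Lemma add_leaf_tree : is_tree T -> is_tree add_leaf.
Proof.
case=> T0 cT acT; split; [|  | exact: add_leaf_acyclic].
  by rewrite card_option.
have SS x y : connect (@edge add_leaf) (Some x) (Some y).
  apply: (connect_homo (f := @Some T)) (cT x y) => a b ab; exact: connect1.
have NS y : connect (@edge add_leaf) None (Some y).
  by apply: connect_trans (SS t0 y); apply: connect1 => /=.
have SN y : connect (@edge add_leaf) (Some y) None.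
  by apply: connect_trans (SS y t0) _; apply: connect1 => /=.
by move=> [x|] [y|].
Qed.
End AddLeaf.

(** * Tree decompositions from splittings *)

(** Connectedness inside [X] is phrased by a relation on [T] itself, so that paths can be carried to
    a tree with an added leaf without subtypes. *)
Definition linked (T : sgraph) (X : {set T}) :=
  {in X &, forall s t, connect [rel a b | [&& a \in X, b \in X & edge a b]] s t}.

Lemma linked_induced (T : sgraph) (X : {set T}) :
  linked X -> connected_graph (induced X).
Proof.
move=> lX [s sX] [t tX].
have /connectP[p] := lX s t sX tX.
elim: p s sX => [|u p IH] s sX /=.
  by move=> _ ts; apply/eq_connect0/val_inj.
case/andP=> /and3P[_ uX su] /(IH u uX) {}IH /IH.
by apply: connect_trans; apply: connect1.
Qed.

Section Decomposition.
Variable G : sgraph.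

Definition closed_edge : rel G := fun x y => (x == y) || edge x y.

(* Requiring every clique to lie in a bag is what lets a new bag be attached
   along a clique; it contains the two covering axioms. *)
Record partial_td (W : {set G}) (T : sgraph) (bag : T -> {set G}) : Prop := PartialTD {
  ptd_tree : is_tree T;
  ptd_sub : forall t, bag t \subset W;
  ptd_clique : forall K : {set G}, is_clique closed_edge K -> K \subset W ->
    exists t, K \subset bag t;
  ptd_linked : forall v, linked [set t | v \in bag t];
  ptd_cover : forall t, cover3 closed_edge (bag t) }.

Lemma partial_td1 (W : {set G}) :
  cover3 closed_edge W -> partial_td W (fun _ : path_graph 1 => W).
Proof.
move=> cW; split=> //.
- split; first by rewrite card_ord.
  + by move=> x y; rewrite (ord1 x) (ord1 y) connect0.
  + move=> c /andP[_ /card_uniqP <-].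
    by apply: leq_trans (max_card _) _; rewrite card_ord.
- by move=> K _ KW; exists ord0.
- by move=> v x y _ _; rewrite (ord1 x) (ord1 y) connect0.
Qed.

(** A clique with a vertex outside [Q] lies in [R], since no edge crosses. A vertex of [R] already
    present in some bag is in [bag t0], so its subtree extends to the leaf. *)
Lemma partial_td_leaf (Q R : {set G}) (T : sgraph) (bag : T -> {set G}) t0 :
  partial_td Q bag -> no_cross closed_edge Q R -> cover3 closed_edge R ->
  Q :&: R \subset bag t0 ->
  partial_td (Q :|: R) (fun t : add_leaf t0 => if t is Some s then bag s else R).
Proof.
case=> tT sT clT lT cT nQR cR QRt; split.
- exact: add_leaf_tree.
- by case=> [t|]; rewrite ?subsetUr // subsetU ?sT.
- move=> K clK KQR; have [KQ|/subsetPn[x xK xQ]] := boolP (K \subset Q).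
    by have [t Kt] := clT K clK KQ; exists (Some t).
  exists None; apply/subsetP => y yK; apply/negPn/negP => yR.
  have xR : x \in R by move: (subsetP KQR _ xK); rewrite inE (negbTE xQ).
  have yQ : y \in Q by move: (subsetP KQR _ yK); rewrite inE (negbTE yR) orbF.
  by have := nQR y x; rewrite !inE xR yQ xQ yR clK // => /(_ isT isT).
- move=> v; pose bag' (t : add_leaf t0) := if t is Some s then bag s else R.
  pose X := [set t : add_leaf t0 | v \in bag' t]; change (linked X).
  have SS x y : v \in bag x -> v \in bag y ->
      connect [rel a b : add_leaf t0 | [&& a \in X, b \in X & edge a b]] (Some x) (Some y).
    move=> vx vy; have := lT v x y; rewrite !inE => /(_ vx vy).
    apply: (connect_homo (f := @Some T)) => a b /=; rewrite !inE => H.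
    by apply: connect1 => /=; rewrite !inE.
  have vt0 x : v \in bag x -> v \in R -> v \in bag t0.
    by move=> vx vR; apply: (subsetP QRt); rewrite inE vR (subsetP (sT x)).
  move=> [x|] [y|]; rewrite !inE => vx vy; rewrite ?connect0 //; first exact: SS.
  + have v0 := vt0 x vx vy; apply: connect_trans (SS _ _ vx v0) _.
    by apply: connect1; rewrite /= !inE v0 vy eqxx.
  + have v0 := vt0 y vy vx; apply: connect_trans (SS _ _ v0 vy).
    by apply: connect1; rewrite /= !inE v0 vx eqxx.
- by case.
Qed.

Hypothesis all_splits : forall W : {set G}, splits closed_edge W.

(** Induction on the size of [W]: the leaf [R] is attached to the single bag [Q], or to the bag of a
    decomposition of [Q] that contains the clique [Q :&: R]. *)
Lemma partial_td_exists (W : {set G}) :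
  exists (T : sgraph) (bag : T -> {set G}), partial_td W bag.
Proof.
elim: {W}_.+1 {-2}W (ltnSn #|W|) => // n IH W Wn.
have [Q [R [WE nQR cR [cQ|[QW clQR]]]]] := all_splits W; rewrite WE.
  do 2 eexists; apply: (@partial_td_leaf _ _ (path_graph 1) _ ord0 (partial_td1 cQ)) => //.
  exact: subsetIl.
have [|T [bag tdQ]] := IH Q; first by rewrite -ltnS; apply: leq_trans Wn.
have [t QRt] := ptd_clique tdQ clQR (subsetIl _ _).
by do 2 eexists; apply: partial_td_leaf tdQ nQR cR QRt.
Qed.

(** The nonempty colour classes form the clique partition; they are among three fibres. *)
Lemma theta_cover3 (B : {set G}) : cover3 closed_edge B -> theta (induced B) <= 3.
Proof.
case=> f fB; rewrite /theta; case: ex_minnP => k _ kmin.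
pose g (x : induced B) := f (val x).
pose P := preim_partition g setT.
apply: (@leq_trans #|P|).
  apply: kmin; apply/existsP; exists P; rewrite eqxx andbT.
  apply/andP; split; first exact: preim_partitionP.
  apply/'forall_implyP => K /imsetP[z _ ->].
  apply/'forall_implyP => x; rewrite !inE /= => /eqP zx.
  apply/'forall_implyP => y; rewrite !inE /= => /eqP zy; apply/implyP => xy.
  have := fB _ _ (valP x) (valP y); rewrite -/(g x) -/(g y) -zx -zy => /(_ erefl).
  by rewrite /closed_edge -val_eqE in xy *; rewrite (negbTE xy).
have PE : P \subset [set [set x | g x == i] | i : 'I_3].
  apply/subsetP => K /imsetP[z _ ->]; apply/imsetP; exists (g z) => //.
  by apply/setP => x; rewrite !inE eq_sym.
by apply: leq_trans (subset_leq_card PE) _; rewrite (leq_trans (leq_imset_card _ _)) ?card_ord.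
Qed.

Lemma tree_theta_le3 : tree_theta G <= 3.
Proof.
have [T [bag [tT _ clT lT cT]]] := partial_td_exists [set: G].
have tv v : exists t, v \in bag t.
  have clv : is_clique closed_edge [set v].
    by move=> x y; rewrite !inE => /eqP -> /eqP ->; rewrite /closed_edge eqxx.
  by have [t] := clT _ clv (subsetT _); rewrite sub1set; exists t.
have te u v : edge u v -> exists t, (u \in bag t) && (v \in bag t).
  move=> uv; have cluv : is_clique closed_edge [set u; v].
    move=> x y; rewrite /closed_edge !inE => /orP[] /eqP -> /orP[] /eqP ->;
      by rewrite ?eqxx ?uv ?[edge v u]edge_sym ?uv ?orbT.
  by have [t] := clT _ cluv (subsetT _); rewrite subUset !sub1set; exists t.
pose D := TreeDecomposition tT tv te (fun v => linked_induced (lT v)).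
rewrite /tree_theta; case: ex_minnP => k _ kmin.
apply: leq_trans (kmin (td_theta D) _) _; first by apply/asboolP; exists D.
by apply/bigmax_leqP => t _; apply/theta_cover3/cT.
Qed.
End Decomposition.

(** * From forbidden induced subgraphs to conditions on closed adjacency *)

(** [isomorphic] asks for a map out of the induced subgraph, so [f], restricted to its image, is
    inverted. *)
Lemma induced_copy (G H : sgraph) (f : H -> G) : injective f ->
  (forall x y, edge (f x) (f y) = edge x y) ->
  exists X : {set G}, isomorphic (induced X) H.
Proof.
move=> fI fE; exists (f @: setT).
pose h (i : H) : induced (f @: setT) := Sub (f i) (imset_f f (in_setT i)).
have [g hK gK] : bijective h.
  apply: inj_card_bij; first by move=> x y /(congr1 val) /= /fI.
  by rewrite card_sig card_imset // cardsT.
exists g; split; first by exists h.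
by move=> x y; rewrite -fE -{2}(gK x) -{2}(gK y).
Qed.

Section Forbidden.
Variable G : sgraph.
Local Notation r := (@closed_edge G).

Lemma closed_edge_refl : reflexive r.
Proof. by move=> x; rewrite /closed_edge eqxx. Qed.

Lemma closed_edge_sym : symmetric r.
Proof. by move=> x y; rewrite /closed_edge eq_sym edge_sym. Qed.

Lemma edge_nonadj x y : ~~ r x y -> edge x y = false /\ edge y x = false.
Proof. by case/norP=> _ /negbTE xy; rewrite [edge y x]edge_sym xy. Qed.

(** The vertex [z] tells [x] and [y] apart, so their closed adjacency is a genuine edge. *)
Lemma edge_adj x y z : r x y -> r x z -> ~~ r y z -> edge x y /\ edge y x.
Proof.
move=> /orP[/eqP <- -> //|xy _ _]; by rewrite [edge y x]edge_sym xy.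
Qed.

Lemma nonadj_neq x y : ~~ r x y -> x != y.
Proof. by case/norP. Qed.

Lemma edge_neq (x y : G) : edge x y -> x != y.
Proof. by apply: contraTneq => ->; rewrite edge_irrefl. Qed.

Lemma closed_edge_C4_free a b c d :
  free [:: dunion (path_graph 4) (path_graph 1); cycle_graph 4] G ->
  r a b -> r b c -> r c d -> r d a -> ~~ r a c -> ~~ r b d -> False.
Proof.
move=> Gfree ab bc cd da ac bd; have sym := closed_edge_sym.
have [eac eca] := edge_nonadj ac; have [ebd edb] := edge_nonadj bd.
have [eab eba] : edge a b /\ edge b a by apply: (edge_adj ab) bd; rewrite sym.
have [ebc ecb] : edge b c /\ edge c b by apply: (edge_adj (z := a)); rewrite // sym.
have [ecd edc] : edge c d /\ edge d c by apply: (edge_adj (z := b)); rewrite // sym.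
have [eda ead] : edge d a /\ edge a d by apply: (edge_adj (z := c)); rewrite // sym.
apply: (Gfree (cycle_graph 4)); first by right; left.
pose f (i : cycle_graph 4) := nth a [:: a; b; c; d] i.
apply: (@induced_copy G (cycle_graph 4) f).
  have u : uniq [:: a; b; c; d].
    by rewrite /= !inE !negb_or (edge_neq eab) (nonadj_neq ac) (edge_neq ead)
               (edge_neq ebc) (nonadj_neq bd) (edge_neq ecd).
  by move=> i j /eqP; rewrite nth_uniq // => /eqP/val_inj.
have es := (eac, eca, ebd, edb, eab, eba, ebc, ecb, ecd, edc, eda, ead, @edge_irrefl G).
move=> [[|[|[|[|//]]]] i] [[|[|[|[|//]]]] j]; rewrite /f /= es.
all: by rewrite /cycle_edge -!val_eqE.
Qed.

Lemma closed_edge_P4P1_free a b c d p :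
  free [:: dunion (path_graph 4) (path_graph 1); cycle_graph 4] G ->
  r a b -> r b c -> r c d -> ~~ r a c -> ~~ r a d -> ~~ r b d ->
  ~~ r p a -> ~~ r p b -> ~~ r p c -> ~~ r p d -> False.
Proof.
move=> Gfree ab bc cd ac ad bd pa pb pc pd; have sym := closed_edge_sym.
have [eac eca] := edge_nonadj ac; have [ead eda] := edge_nonadj ad.
have [ebd edb] := edge_nonadj bd; have [epa eap] := edge_nonadj pa.
have [epb ebp] := edge_nonadj pb; have [epc ecp] := edge_nonadj pc.
have [epd edp] := edge_nonadj pd.
have [eba eab] : edge b a /\ edge a b by apply: (edge_adj (z := c)); rewrite // sym.
have [ebc ecb] : edge b c /\ edge c b by apply: (edge_adj (z := a)); rewrite // sym.
have [ecd edc] : edge c d /\ edge d c by apply: (edge_adj (z := b)); rewrite // sym.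
apply: (Gfree (dunion (path_graph 4) (path_graph 1))); first by left.
pose f (i : dunion (path_graph 4) (path_graph 1)) :=
  if i is inl j then nth a [:: a; b; c; d] j else p.
apply: (@induced_copy G (dunion (path_graph 4) (path_graph 1)) f).
  (* With [p] in front, [uniq] yields both that [p] is off the path and that the path has no
     repetition. *)
  have u : uniq [:: p; a; b; c; d].
    by rewrite /= !inE !negb_or (edge_neq eab) (edge_neq ebc) (edge_neq ecd)
               !(nonadj_neq ac, nonadj_neq ad, nonadj_neq bd, nonadj_neq pa,
                 nonadj_neq pb, nonadj_neq pc, nonadj_neq pd).
  case/andP: u => pN u.
  have fp (i : 'I_4) : nth a [:: a; b; c; d] i != p.
    by apply: contraNneq pN => <-; rewrite mem_nth.
  move=> [i|i] [j|j] //=.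
  - by move=> /eqP; rewrite nth_uniq // => /eqP/val_inj ->.
  - by move=> /eqP; rewrite (negbTE (fp i)).
  - by move=> /esym/eqP; rewrite (negbTE (fp j)).
  - by rewrite (ord1 i) (ord1 j).
have es := (eac, eca, ebd, edb, eab, eba, ebc, ecb, ecd, edc, eda, ead,
  epa, eap, epb, ebp, epc, ecp, epd, edp, @edge_irrefl G).
by move=> [[[|[|[|[|//]]]] i]|i] [[[|[|[|[|//]]]] j]|j];
  rewrite /f /= es // (ord1 i) (ord1 j).
Qed.
End Forbidden.

Theorem theorem1p10 (G : sgraph) :
  free [:: dunion (path_graph 4) (path_graph 1); cycle_graph 4] G ->
  tree_theta G <= 3.
Proof.
move=> Gfree; apply: tree_theta_le3 => W; apply: splitsP.
- exact: closed_edge_refl.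
- exact: closed_edge_sym.
- by move=> a b c d; apply: closed_edge_C4_free.
- by move=> a b c d p; apply: closed_edge_P4P1_free.
Qed.
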